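(* Let $I,J\subset\mathbb{R}$ be open intervals and let $u:I\to\mathbb{R}$, $v:J\to\mathbb{R}$ be smooth functions. Consider the translation surface of type 4 in the Heisenberg group $\mathrm{Nil}_3$, parametrized by $$r(x,y)=(0,y,v(y))*(x,0,u(x))=\Big(x,\,y,\,u(x)+v(y)-\frac{xy}{2}\Big),\qquad (x,y)\in I\times J.$$ This surface is minimal if and only if there exist constants $a,c,u_0,v_0\in\mathbb{R}$ such that $$u(x)=c\left[(a+x)\sqrt{1+(a+x)^2}+\ln\left(a+x+\sqrt{1+(a+x)^2}\right)\right]+u_0\quad\text{for all }x\in I,$$ $$v(y)=-ay+v_0\quad\text{for all }y\in J.$$
   Context: The Heisenberg group $\mathrm{Nil}_3$ is $\mathbb{R}^3$ with the group operation $$(x,y,z)*(\overline{x},\overline{y},\overline{z})=\Big(x+\overline{x},\ y+\overline{y},\ z+\overline{z}+\frac{x\overline{y}}{2}-\frac{\overline{x}y}{2}\Big),$$ equipped with the left invariant Riemannian metric $$\tilde g=dx^2+dy^2+\Big(dz+\tfrac12(y\,dx-x\,dy)\Big)^2.$$ A translation surface in $\mathrm{Nil}_3$ is a surface parametrized as the $*$-product of two curves lying in coordinate planes of $\mathbb{R}^3$. It is of type 4 when it is $M(\gamma_2,\gamma_1)=\gamma_2(y)*\gamma_1(x)$ with $\gamma_1(x)=(x,0,u(x))$ and $\gamma_2(y)=(0,y,v(y))$, $u,v$ smooth. A surface immersed in $(\mathrm{Nil}_3,\tilde g)$ is minimal if its mean curvature $H=\frac12\mathrm{trace}(A)$ vanishes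 identically, where $A$ is the shape operator with respect to a unit normal and the metric $\tilde g$. *)

(* Defs.v *)
From mathcomp Require Import all_boot all_order all_algebra.
From mathcomp Require Import all_classical all_reals all_analysis.
Export numFieldNormedType.Exports.
Set Implicit Arguments.
Unset Strict Implicit.
Unset Printing Implicit Defensive.

Import Order.TTheory GRing.Theory Num.Theory.
Local Open Scope classical_set_scope.
Local Open Scope ring_scope.

(* The derivatives are those of a total function R -> R, but since [I] is meant
   to be open they only depend on the restriction of [f] to [I]. *)
Definition smooth_on (R : realType) (I : set R) (f : R -> R) : Prop :=
  forall (n : nat) (x : R), I x -> derivable (derive1n n f) x 1.

Section Riemannian_R3.
Variable R : realType.

(* [g p v w] is the scalar product of the tangent vectors v, w at p. *)
Variable g : 'rV[R]_3 -> 'rV[R]_3 -> 'rV[R]_3 -> R.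

Definition basis3 (i : 'I_3) : 'rV[R]_3 := delta_mx 0 i.

Definition gram (p : 'rV[R]_3) : 'M[R]_3 :=
  \matrix_(i, j) g p (basis3 i) (basis3 j).

Definition partial_gram (l i j : 'I_3) (p : 'rV[R]_3) : R :=
  'D_(basis3 l) (fun q => gram q i j) p.

(* Gamma^k_ij for the Levi-Civita connection of g. *)
Definition christoffel (k i j : 'I_3) (p : 'rV[R]_3) : R :=
  2^-1 * \sum_(l < 3) invmx (gram p) k l *
    (partial_gram i j l p + partial_gram j i l p - partial_gram l i j p).

(* Levi-Civita derivative, in the direction w of the parameter plane, of a
   vector field X along r; X s is a tangent vector at the point r s. *)
Definition covariant_derivative (r X : 'rV[R]_2 -> 'rV[R]_3)
    (s : 'rV[R]_2) (w : 'rV[R]_2) : 'rV[R]_3 :=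
  'D_w X s +
  \row_k \sum_(i < 3) \sum_(j < 3)
    christoffel k i j (r s) * ('D_w r s) 0 i * (X s) 0 j.

Definition immersion_on (U : set 'rV[R]_2) (r : 'rV[R]_2 -> 'rV[R]_3) : Prop :=
  forall s, U s -> differentiable r s /\ row_free ('J r s).

(* A unit normal is determined up to sign, so a differentiable one is
   automatically as regular as the tangent planes of r. *)
Definition unit_normal_on (U : set 'rV[R]_2) (r N : 'rV[R]_2 -> 'rV[R]_3)
    : Prop :=
  forall s, U s ->
    [/\ differentiable N s,
        forall w : 'rV[R]_2, g (r s) ('D_w r s) (N s) = 0
      & g (r s) (N s) (N s) = 1].

(* dr (A w) = - nabla_w N: the shape operator is expressed as an endomorphism
   of the parameter plane, which dr identifies with the tangent plane. Vectors
   are rows, so A s acts on the right. *)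
Definition shape_operator_on (U : set 'rV[R]_2) (r N : 'rV[R]_2 -> 'rV[R]_3)
    (A : 'rV[R]_2 -> 'M[R]_2) : Prop :=
  forall s, U s -> forall w : 'rV[R]_2,
    'D_(w *m A s) r s = - covariant_derivative r N s w.

Definition mean_curvature (A : 'M[R]_2) : R := 2^-1 * \tr A.

(* For an immersion, N determines A, and replacing N by - N replaces A by - A;
   hence the condition does not depend on the choice of N. *)
Definition minimal_on (U : set 'rV[R]_2) (r : 'rV[R]_2 -> 'rV[R]_3) : Prop :=
  immersion_on U r /\
  exists (N : 'rV[R]_2 -> 'rV[R]_3) (A : 'rV[R]_2 -> 'M[R]_2),
    [/\ unit_normal_on U r N,
        shape_operator_on U r N A
      & forall s, U s -> mean_curvature (A s) = 0].

End Riemannian_R3.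

Section Nil3.
Variable R : realType.

Definition vec3 (x y z : R) : 'rV[R]_3 := \row_(i < 3) [:: x; y; z]`_i.

Definition xcoord (p : 'rV[R]_3) : R := p 0 0.
Definition ycoord (p : 'rV[R]_3) : R := p 0 1.
Definition zcoord (p : 'rV[R]_3) : R := p 0 2.

Definition nil3_mul (p q : 'rV[R]_3) : 'rV[R]_3 :=
  vec3 (xcoord p + xcoord q)
       (ycoord p + ycoord q)
       (zcoord p + zcoord q
        + xcoord p * ycoord q / 2 - xcoord q * ycoord p / 2).

(* dz + (y dx - x dy) / 2 at p *)
Definition nil3_form (p v : 'rV[R]_3) : R :=
  zcoord v + (ycoord p * xcoord v - xcoord p * ycoord v) / 2.

Definition nil3_metric (p v w : 'rV[R]_3) : R :=
  xcoord v * xcoord w + ycoord v * ycoord w + nil3_form p v * nil3_form p w.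

Definition curve_xz (u : R -> R) (x : R) : 'rV[R]_3 := vec3 x 0 (u x).
Definition curve_yz (v : R -> R) (y : R) : 'rV[R]_3 := vec3 0 y (v y).

(* The parameters (x, y) are the two entries of s. *)
Definition translation_surface4 (u v : R -> R) (s : 'rV[R]_2) : 'rV[R]_3 :=
  nil3_mul (curve_yz v (s 0 1)) (curve_xz u (s 0 0)).

Definition rectangle (I J : set R) : set 'rV[R]_2 :=
  [set s | I (s 0 0) /\ J (s 0 1)].

Lemma translation_surface4E (u v : R -> R) (s : 'rV[R]_2) :
  let x := s 0 0 in let y := s 0 1 in
  translation_surface4 u v s = vec3 x y (u x + v y - x * y / 2).
Proof.
rewrite /= /translation_surface4 /nil3_mul /xcoord /ycoord /zcoord !mxE /=.
by rewrite add0r addr0 !mul0r addr0 [v _ + _]addrC.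
Qed.

End Nil3.

(* Main.v *)
(* In the left-invariant orthonormal frame E1 = d_x - (y/2) d_z,
   E2 = d_y + (x/2) d_z, E3 = d_z, the tangent plane of the surface is spanned
   by E1 + p E3 and E2 + q E3 with p = u'(x) and q = v'(y) - x, so that a unit
   normal is n (- p E1 - q E2 + E3) with n^2 (1 + p^2 + q^2) = 1. The connection
   terms cancel in the trace of the shape operator, which is (p n)_x + (q n)_y;
   minimality is thus the equation
     (1 + q^2) u'' + p q + (1 + p^2) v'' = 0.
   For fixed y, solving it for v'' gives a quadratic polynomial in v' whose
   coefficients depend on x only. If v' took two values, it would take three,
   so the coefficients would be constant in x, which forces u' = u'' = 0, hence
   v'' = 0, a contradiction. So v' = - a, and the equation becomes
   (1 + (a + x)^2) u'' = (a + x) u', i.e. u' / sqrt (1 + (a + x)^2) is constant. *)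

Require Import Defs.
From mathcomp Require Import all_boot all_order all_algebra.
From mathcomp Require Import all_classical all_reals all_analysis.
From mathcomp Require Import ring lra.
Import Order.TTheory GRing.Theory Num.Theory.
Local Open Scope classical_set_scope.
Local Open Scope ring_scope.
Set Implicit Arguments.
Unset Strict Implicit.
Unset Printing Implicit Defensive.

(** * The minimal surface equation *)

Lemma is_derive0_cst_on (R : realType) (I : set R) (f : R -> R) :
  is_interval I -> (forall x, I x -> is_derive x 1 f 0) ->
  forall x y, I x -> I y -> f x = f y.
Proof.
move=> intI df x y Ix Iy; wlog xy : x y Ix Iy / x <= y.
  by move=> H; case: (leP x y) => [|/ltW] yx; [|symmetry]; apply: H.
have sub z : z \in `[x, y] -> I z.
  by rewrite in_itv /= => zxy; exact: intI Ix Iy _ zxy.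
have [||c _] := @MVT_segment R f (fun=> 0) x y xy.
- by move=> z zxy; apply/df/sub; apply: subset_itv_oo_cc.
- apply: derivable_within_continuous => z zxy.
  by have [] := df z (sub z zxy).
- by rewrite mul0r => /eqP; rewrite subr_eq0 => /eqP ->.
Qed.

Lemma derivable_is_derive1 (R : realType) (f : R -> R) x :
  derivable f x 1 -> is_derive x 1 f (derive1 f x).
Proof. by move=> df; rewrite derive1E; exact: derivableP. Qed.

Lemma smooth_on_derivable (R : realType) (I : set R) (f : R -> R) :
  smooth_on I f -> forall x, I x ->
  is_derive x 1 f (derive1 f x) /\
  is_derive x 1 (derive1 f) (derive1 (derive1 f) x).
Proof.
move=> sf x Ix; split; apply: derivable_is_derive1.
- exact: (sf 0%N).
- by have := sf 1%N x Ix; rewrite derive1n1.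
Qed.

(** A derivative sees only values near [x], so a formula known merely on the open set [I] can be
    differentiated there. *)
Lemma derive1_eq_on (R : realType) (I : set R) (f g : R -> R) x (l : R) :
  open I -> I x -> (forall t, I t -> f t = g t) -> is_derive x 1 g l ->
  derive1 f x = l.
Proof.
move=> oI Ix fg dg; rewrite derive1E; have [_ <-] := dg.
apply: near_eq_derive; near=> t; apply: fg.
by near: t; exact: open_nbhs_nbhs.
Unshelve. all: by end_near. Qed.

(** Divided differences: subtracting the equations at two points and cancelling the difference of
    the points lowers the degree by one; doing so twice isolates [a]. *)
Lemma quadratic_eq0 (R : realFieldType) (a b c t1 t2 t3 : R) :
  t1 != t2 -> t1 != t3 -> t2 != t3 ->
  (forall t, t = t1 \/ t = t2 \/ t = t3 -> a * t ^+ 2 + b * t + c = 0) ->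
  [/\ a = 0, b = 0 & c = 0].
Proof.
move=> t12 t13 t23 h.
have h1 := h t1 (or_introl erefl).
have h2 := h t2 (or_intror (or_introl erefl)).
have h3 := h t3 (or_intror (or_intror erefl)).
have s12 : a * (t1 + t2) + b = 0.
  apply: (mulIf (x := t1 - t2)); first by rewrite subr_eq0.
  by rewrite mul0r; lra.
have s13 : a * (t1 + t3) + b = 0.
  apply: (mulIf (x := t1 - t3)); first by rewrite subr_eq0.
  by rewrite mul0r; lra.
have a0 : a = 0.
  apply: (mulIf (x := t2 - t3)); first by rewrite subr_eq0.
  by rewrite mul0r; lra.
move: s12 h1; rewrite a0 !mul0r !add0r => -> h1.
by split=> //; move: h1; rewrite mul0r add0r.
Qed.

Lemma three_points_open (R : realType) (I : set R) : open I -> I !=set0 ->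
  exists t1 t2 t3, [/\ I t1, I t2 & I t3] /\ [/\ t1 != t2, t1 != t3 & t2 != t3].
Proof.
move=> oI [x Ix]; have /nbhs_ballP[e /= e0 eI] := open_nbhs_nbhs (conj oI Ix).
exists (x - e / 2), x, (x + e / 2).
have e20 : 0 < e / 2 by rewrite divr_gt0.
split; split=> //.
- apply: eI; rewrite /ball /= opprB addrC subrK gtr0_norm//.
  by rewrite ltr_pdivrMr// ltr_pMr// ltr1n.
- apply: eI; rewrite /ball /= opprD addrA subrr sub0r normrN gtr0_norm//.
  by rewrite ltr_pdivrMr// ltr_pMr// ltr1n.
- by rewrite lt_eqF// ltrBlDr ltrDl.
- by rewrite lt_eqF//; lra.
- by rewrite lt_eqF// ltrDl.
Qed.

(** By the intermediate value theorem the mean of the two given values is attained. *)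
Lemma three_values (R : realType) (J : set R) (w : R -> R) :
  is_interval J -> (forall y, J y -> derivable w y 1) ->
  forall y1 y2, J y1 -> J y2 -> w y1 != w y2 ->
  exists y3, [/\ J y3, w y1 != w y3 & w y2 != w y3].
Proof.
move=> intJ dw y1 y2; wlog y12 : y1 y2 / y1 <= y2.
  move=> H Jy1 Jy2 w12; case: (leP y1 y2) => [|/ltW] yx; first exact: H.
  by have [//|y3 []] := H y2 y1 yx Jy2 Jy1; [rewrite eq_sym|exists y3].
move=> Jy1 Jy2 w12.
have sub z : z \in `[y1, y2] -> J z.
  by rewrite in_itv /= => zxy; exact: intJ Jy1 Jy2 _ zxy.
have [||y3 /sub Jy3 wy3] := @IVT _ w y1 y2 ((w y1 + w y2) / 2) y12.
- by apply: derivable_within_continuous => z /sub; exact: dw.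
- rewrite ge_min le_max; case: (leP (w y1) (w y2)) => ?; apply/andP; split;
    apply/orP; (by left; lra) || (by right; lra).
- exists y3; split=> //; rewrite wy3; apply/eqP => h; move/eqP: w12; apply; lra.
Qed.

(** * The solution profile and affine functions *)

Lemma is_derive1_sqrt_sq (R : realType) (a x : R) :
  is_derive x 1 (fun t => Num.sqrt (1 + (a + t) ^+ 2))
    ((a + x) / Num.sqrt (1 + (a + x) ^+ 2)).
Proof.
have p0 : 0 < 1 + (a + x) ^+ 2 by rewrite ltr_pwDl// sqr_ge0.
have dq : is_derive x 1 (fun t : R => 1 + (a + t) ^+ 2) (2 * (a + x)).
  apply: is_derive_eq; rewrite /GRing.scale /=; ring.
refine (is_derive_eq (@is_derive1_comp _ _ (fun t : R => 1 + (a + t) ^+ 2)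
  _ _ _ (is_derive1_sqrt p0) dq) _).
by field; rewrite sqrtr_eq0 -ltNge.
Qed.

(** With S the square root at [x], the product contributes S + (a + x)^2 / S and the logarithm 1 /
    S; since (a + x)^2 = S^2 - 1, the sum is 2 S. *)
Lemma is_derive1_profile (R : realType) (a x : R) :
  is_derive x 1 (fun t => (a + t) * Num.sqrt (1 + (a + t) ^+ 2)
                          + ln (a + t + Num.sqrt (1 + (a + t) ^+ 2)))
    (2 * Num.sqrt (1 + (a + x) ^+ 2)).
Proof.
have dS := is_derive1_sqrt_sq a x; set S := Num.sqrt (1 + (a + x) ^+ 2) in dS *.
have SS : S ^+ 2 = 1 + (a + x) ^+ 2 by rewrite sqr_sqrtr// addr_ge0// sqr_ge0.
have S0 : 0 < S by rewrite sqrtr_gt0 ltr_pwDl// sqr_ge0.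
(* The logarithm has a positive argument because S exceeds the absolute value of a + x. *)
have aS : 0 < a + x + S.
  suff : - (a + x) < S by lra.
  rewrite (le_lt_trans (ler_norm _))// normrN -sqrtr_sqr.
  by rewrite ltr_sqrt ?ltr_pwDl ?sqr_ge0// ltrDr.
have dl : is_derive x 1 (fun t => a + t + Num.sqrt (1 + (a + t) ^+ 2))
    (1 + (a + x) / S).
  by apply: is_derive_eq; rewrite add0r.
have dln := @is_derive1_comp _ _ (fun t => a + t + Num.sqrt (1 + (a + t) ^+ 2))
  _ _ _ (is_derive1_ln aS) dl.
refine (is_derive_eq (is_deriveD _ dln) _).
rewrite /GRing.scale /= -/S add0r !mulr1.
have -> : (a + x + S)^-1 * (1 + (a + x) / S) = S^-1 by field; rewrite !gt_eqF.
have -> : (a + x) * ((a + x) / S) = (S ^+ 2 - 1) / S.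
  by rewrite SS; field; rewrite gt_eqF.
by field; rewrite gt_eqF.
Qed.

Lemma affine_of_derive1_cst (R : realType) (J : set R) (v : R -> R) (b : R) :
  is_interval J -> J !=set0 -> (forall y, J y -> is_derive y 1 v b) ->
  exists v0, forall y, J y -> v y = b * y + v0.
Proof.
move=> intJ [y0 Jy0] dv; exists (v y0 - b * y0) => y Jy.
suff : v y - b * y = v y0 - b * y0 by lra.
apply: (@is_derive0_cst_on _ J (fun t => v t - b * t)) => // t /dv dvt.
by apply: is_derive_eq; rewrite /GRing.scale /=; ring.
Qed.

(** * Solving the minimal surface equation *)

Section minimal_surface_equation.
Variables (R : realType) (I J : set R) (u v : R -> R).
Hypotheses (openI : open I) (intI : is_interval I) (I0 : I !=set0).
Hypotheses (openJ : open J) (intJ : is_interval J) (J0 : J !=set0).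
Hypotheses (smu : smooth_on I u) (smv : smooth_on J v).

Let u' : R -> R := derive1 u.
Let u'' : R -> R := derive1 u'.
Let v' : R -> R := derive1 v.
Let v'' : R -> R := derive1 v'.

(** [px] and [qy] stand for the partial derivatives p_x = u'' and q_y = v''. *)
Definition minimal_equation (p q px qy : R) : R :=
  (1 + q ^+ 2) * px + p * q + (1 + p ^+ 2) * qy.

Lemma minimal_equation_cst : (forall x y, I x -> J y ->
    minimal_equation (u' x) (v' y - x) (u'' x) (v'' y) = 0) ->
  forall y1 y2, J y1 -> J y2 -> v' y1 = v' y2.
Proof.
move=> E y1 y2 Jy1 Jy2; apply/eqP/negP => /negP w12.
have [|y3 [Jy3 w13 w23]] := three_values intJ _ Jy1 Jy2 w12.
  by move=> y /(smooth_on_derivable smv)[_ []].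
have [x1 [x2 [x3 [[Ix1 Ix2 Ix3] [x12 x13 x23]]]]] := three_points_open openI I0.
(* Division by 1 + u'^2 turns the equation into v'' = - (al (1 + (v' - x)^2) + be (v' - x)), which
   [vE] sorts by powers of v'. *)
pose al x := u'' x / (1 + u' x ^+ 2).
pose be x := u' x / (1 + u' x ^+ 2).
have vE x y : I x -> J y -> v'' y =
    - (al x * v' y ^+ 2 + (be x - 2 * x * al x) * v' y
       + (al x * (1 + x ^+ 2) - x * be x)).
  move=> Ix Jy; have := E x y Ix Jy; rewrite /minimal_equation => e.
  have d0 : 1 + u' x ^+ 2 != 0 by rewrite gt_eqF// ltr_pwDl// sqr_ge0.
  apply: (mulfI d0); rewrite /al /be.
  apply/eqP; rewrite -subr_eq0; apply/eqP; rewrite -[RHS]e; field; exact: d0.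
(* For fixed y the value v'' y is the same at x and at [x1], so the difference of the two quadratics
   vanishes at three values of v'. *)
have coef x : I x -> [/\ al x - al x1 = 0,
    (be x - 2 * x * al x) - (be x1 - 2 * x1 * al x1) = 0 &
    (al x * (1 + x ^+ 2) - x * be x) - (al x1 * (1 + x1 ^+ 2) - x1 * be x1) = 0].
  move=> Ix; apply: (quadratic_eq0 w12 w13 w23) => t ht.
  have [y Jy ->] : exists2 y, J y & t = v' y.
    by case: ht => [->|[->|->]]; [exists y1|exists y2|exists y3].
  have := vE x y Ix Jy; rewrite (vE x1 y Ix1 Jy); lra.
set k := al x1 in coef; set m := be x1 - 2 * x1 * k in coef.
(* On I, [al] = k and [be] = m + 2 t k; the third identity of [coef] becomes a quadratic in t with
   leading coefficients - k and - m, vanishing at three points of I. *)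
have [k0 m0 _] : [/\ - k = 0, - m = 0 &
    k - (k * (1 + x1 ^+ 2) - x1 * be x1) = 0].
  apply: (quadratic_eq0 x12 x13 x23) => t ht.
  have It : I t by case: ht => [->|[->|->]].
  have [c1 c2] := coef t It.
  have -> : al t = k by lra.
  move: c2; have -> : al t = k by lra.
  move=> c2; have -> : be t = m + 2 * t * k by lra.
  by move=> <-; ring.
have al0 : al x1 = 0 by rewrite -/k; lra.
have be0 : be x1 = 0 by move: m0; rewrite /m /k al0; lra.
have v''0 y : J y -> is_derive y 1 v' 0.
  move=> Jy; have [_ dv'] := smooth_on_derivable smv Jy.
  refine (is_derive_eq dv' _); rewrite -/v' -/v'' (vE x1 y Ix1 Jy) al0 be0; ring.
by move/eqP: w12; apply; exact: (is_derive0_cst_on intJ v''0 Jy1 Jy2).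
Qed.

Lemma minimal_equationP :
  (forall x y, I x -> J y ->
    minimal_equation (u' x) (v' y - x) (u'' x) (v'' y) = 0) <->
  exists a c u0 v0 : R,
    (forall x, I x ->
       u x = c * ((a + x) * Num.sqrt (1 + (a + x) ^+ 2)
                  + ln (a + x + Num.sqrt (1 + (a + x) ^+ 2))) + u0)
    /\ (forall y, J y -> v y = - a * y + v0).
Proof.
pose S (a x : R) : R := Num.sqrt (1 + (a + x) ^+ 2).
have SS a x : S a x ^+ 2 = 1 + (a + x) ^+ 2.
  by rewrite sqr_sqrtr// addr_ge0// sqr_ge0.
have S0 a x : S a x != 0 by rewrite gt_eqF// sqrtr_gt0 ltr_pwDl// sqr_ge0.
split=> [E|[a [c [u0 [v0 [uE vE]]]]] x y Ix Jy].
- have [y0 Jy0] := J0; have [x0 Ix0] := I0.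
  have v'c y : J y -> v' y = v' y0 by move=> Jy; exact: minimal_equation_cst.
  pose a := - v' y0.
  have v''0 : v'' y0 = 0.
    by apply: (derive1_eq_on _ _ v'c (is_derive_cst (v' y0) y0 1)).
  have [v0 v0E] : exists v0, forall y, J y -> v y = - a * y + v0.
    apply: affine_of_derive1_cst => // y Jy; rewrite opprK -(v'c y Jy).
    by have [] := smooth_on_derivable smv Jy.
  (* The 2 compensates the factor in the derivative 2 S of the profile. *)
  pose c := u' x0 / S a x0 / 2.
  have u'E x : I x -> u' x = c * (2 * S a x).
    move=> Ix; suff : u' x / S a x = u' x0 / S a x0.
      by move=> h; rewrite /c -h; field; rewrite S0.
    apply: (@is_derive0_cst_on _ I (fun t => u' t / S a t)) => // t It.
    have [_ du'] := smooth_on_derivable smu It.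
    have dS := is_deriveV (S0 a t) (is_derive1_sqrt_sq a t).
    refine (is_derive_eq (is_deriveM du' dS) _); rewrite /GRing.scale /= -/(S a t).
    have := E t y0 It Jy0; rewrite /minimal_equation v''0 mulr0 addr0.
    rewrite -/u' -/u'' (_ : v' y0 - t = - (a + t)); last by rewrite /a; ring.
    rewrite sqrrN -SS => e.
    (* Multiplied by S^3, the derivative of u' / S becomes S^2 u'' - (a + t) u', the left side of
       the equation at v'' = 0. *)
    apply: (mulIf (expf_neq0 3 (S0 a t))); rewrite mul0r -[RHS]e.
    by field; rewrite S0.
  pose h x := (a + x) * S a x + ln (a + x + S a x).
  exists a, c, (u x0 - c * h x0), v0; split=> // x Ix.
  suff : u x - c * h x = u x0 - c * h x0 by rewrite -/(h x); lra.
  apply: (@is_derive0_cst_on _ I (fun t => u t - c * h t)) => // t It.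
  have [du _] := smooth_on_derivable smu It.
  have dh := is_derive1_profile a t.
  apply: is_derive_eq; rewrite -/u' (u'E t It) /GRing.scale /= -/(S a t); ring.
- have v'E y' : J y' -> v' y' = - a.
    move=> Jy'; apply: (derive1_eq_on _ _ vE) => //.
    by apply: is_derive_eq; rewrite /GRing.scale /= mulr1 addr0.
  have v''E : v'' y = 0 by apply: (derive1_eq_on _ _ v'E).
  have u'E x' : I x' -> u' x' = c * (2 * S a x').
    move=> Ix'; apply: (derive1_eq_on _ _ uE) => //.
    have dh := is_derive1_profile a x'.
    by apply: is_derive_eq; rewrite addr0.
  have u''E : u'' x = c * (2 * ((a + x) / S a x)).
    apply: (derive1_eq_on _ _ u'E) => //; have dS := is_derive1_sqrt_sq a x.
    by apply: is_derive_eq.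
  rewrite /minimal_equation v''E u''E u'E// v'E//.
  rewrite (_ : - a - x = - (a + x)); last by ring.
  by rewrite sqrrN -SS; field; rewrite S0.
Qed.

End minimal_surface_equation.

(** * The Levi-Civita connection of Nil3 *)

Lemma ord3_cases (i : 'I_3) : [\/ i = 0, i = 1 | i = 2].
Proof.
by case: i => [[|[|[|//]]] h]; [constructor 1|constructor 2|constructor 3];
  apply: val_inj.
Qed.

Lemma sum_ord3 (V : nmodType) (F : 'I_3 -> V) :
  \sum_(i < 3) F i = F 0 + F 1 + F 2.
Proof.
rewrite !big_ord_recl big_ord0 addr0 addrA.
by congr (F _ + F _ + F _); apply: val_inj.
Qed.

Lemma sum_ord2 (V : nmodType) (F : 'I_2 -> V) : \sum_(i < 2) F i = F 0 + F 1.
Proof.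
rewrite !big_ord_recl big_ord0 addr0.
by congr (F _ + F _); apply: val_inj.
Qed.

Lemma is_derive_coord (R : realFieldType) n (s w : 'rV[R]_n) i :
  is_derive s w (fun t : 'rV[R]_n => t 0 i) (w 0 i).
Proof.
have did : derivable (fun t : 'rV[R]_n => t) s w by exact: derivable_id.
apply: DeriveDef; first by move/derivable_mxP : did.
have := congr1 (fun M : 'rV[R]_n => M 0 i) (derive_mx did).
by rewrite derive_id mxE.
Qed.

Lemma is_derive_row (R : realFieldType) (V : normedModType R) n
    (X : V -> 'rV[R]_n) s w i :
  derivable X s w -> is_derive s w (fun t => X t 0 i) ('D_w X s 0 i).
Proof.
move=> dX; apply: DeriveDef; first by move/derivable_mxP : dX.
by rewrite derive_mx// mxE.
Qed.

Lemma differentiable_comp_coord (R : realType) n (f : R -> R) (s : 'rV[R]_n) i l :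
  is_derive (s 0 i) 1 f l -> differentiable (fun t : 'rV[R]_n => f (t 0 i)) s.
Proof.
move=> [/derivable1_diffP df _].
exact: (@differentiable_comp _ _ _ _ (fun t : 'rV[R]_n => t 0 i) f s
  (differentiable_coord _ _ _) df).
Qed.

Lemma is_derive_comp_coord (R : realType) n (f : R -> R) (s w : 'rV[R]_n) i l :
  is_derive (s 0 i) 1 f l ->
  is_derive s w (fun t : 'rV[R]_n => f (t 0 i)) (l * w 0 i).
Proof.
move=> df; have dfs := differentiable_comp_coord df.
apply: DeriveDef; first exact: diff_derivable.
case: df => df <-; have /derivable1_diffP df' := df.
rewrite deriveE//.
rewrite (@diff_comp _ _ _ _ (fun t : 'rV[R]_n => t 0 i) f s
  (differentiable_coord _ _ _) df') /=.
rewrite -(deriveE _ (differentiable_coord _ _ _)).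
have [_ ->] := is_derive_coord s w i.
by rewrite deriv1E// derive1E mulrC.
Qed.

(** * Christoffel symbols and covariant derivative *)

Section Nil3_connection.
Variable R : realType.
Implicit Types p v w : 'rV[R]_3.

Lemma vec3_eta p : p = vec3 (p 0 0) (p 0 1) (p 0 2).
Proof.
by apply/rowP => i; rewrite mxE; case: (ord3_cases i) => ->.
Qed.

(** dx, dy and [nil3_form p] form the coframe dual to E1, E2, E3. Below, vectors are compared
    through these three values rather than through the z-coordinate. *)
Lemma nil3_form_inj p v w : v 0 0 = w 0 0 -> v 0 1 = w 0 1 ->
  nil3_form p v = nil3_form p w -> v = w.
Proof.
rewrite /nil3_form /xcoord /ycoord /zcoord => e0 e1; rewrite e0 e1 => /addIr e2.
by rewrite (vec3_eta v) (vec3_eta w) e0 e1 e2.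
Qed.

Lemma is_derive_nil3_metric p w v1 v2 :
  is_derive p w (fun q => nil3_metric q v1 v2)
    (nil3_form p v1 * ((w 0 1 * v2 0 0 - w 0 0 * v2 0 1) / 2)
     + nil3_form p v2 * ((w 0 1 * v1 0 0 - w 0 0 * v1 0 1) / 2)).
Proof.
have dx := is_derive_coord p w 0; have dy := is_derive_coord p w 1.
rewrite /nil3_metric /nil3_form /xcoord /ycoord /zcoord.
apply: is_derive_eq; rewrite /GRing.scale /=; ring.
Qed.

(** The metric on covectors: the sum of the outer squares of the orthonormal vectors E1, E2, E3
    written in coordinates. *)
Definition nil3_cogram p : 'M[R]_3 := \matrix_(i, j)
  (nth [::] [:: [:: 1; 0; - p 0 1 / 2];
                [:: 0; 1; p 0 0 / 2];
                [:: - p 0 1 / 2; p 0 0 / 2; 1 + (p 0 0 ^+ 2 + p 0 1 ^+ 2) / 4]]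
     i)`_j.

Lemma invmx_nil3_gram p : invmx (gram (@nil3_metric R) p) = nil3_cogram p.
Proof.
have gc : gram (@nil3_metric R) p *m nil3_cogram p = 1%:M.
  apply/matrixP => i j; rewrite mxE sum_ord3 !mxE.
  rewrite /nil3_metric /nil3_form /xcoord /ycoord /zcoord.
  by case: (ord3_cases i) => ->; case: (ord3_cases j) => ->; rewrite !mxE /=; field.
have [ug _] := mulmx1_unit gc.
by rewrite -[LHS]mulmx1 -gc mulKmx.
Qed.

(** Each Boolean difference is a value of dy /\ dx on two basis vectors; half of it is the
    derivative of [nil3_form] on the second one along the first. *)
Lemma partial_gram_nil3 p (l i j : 'I_3) :
  partial_gram (@nil3_metric R) l i j p =
    nil3_form p (basis3 R i)
      * (((l == 1) && (j == 0))%:R - ((l == 0) && (j == 1))%:R) / 2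
    + nil3_form p (basis3 R j)
      * (((l == 1) && (i == 0))%:R - ((l == 0) && (i == 1))%:R) / 2.
Proof.
rewrite /partial_gram; have -> : (fun q => gram (@nil3_metric R) q i j) =
    (fun q => nil3_metric q (basis3 R i) (basis3 R j)).
  by apply/funext => q; rewrite mxE.
have [_ ->] := is_derive_nil3_metric p (basis3 R l) (basis3 R i) (basis3 R j).
rewrite !mxE !eqxx /= -!natrM !mulnb.
by rewrite [1 == l]eq_sym [1 == i]eq_sym [1 == j]eq_sym
  [0 == l]eq_sym [0 == i]eq_sym [0 == j]eq_sym !mulrA.
Qed.

Lemma nil3_form_basis p i :
  nil3_form p (basis3 R i) = [:: p 0 1 / 2; - p 0 0 / 2; 1]`_i.
Proof.
rewrite /nil3_form /xcoord /ycoord /zcoord.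
by case: (ord3_cases i) => ->; rewrite !mxE /=; field.
Qed.

(** These are the frame relations nabla_E1 E2 = - nabla_E2 E1 = E3 / 2, nabla_E1 E3 = nabla_E3 E1 =
    - E2 / 2, nabla_E2 E3 = nabla_E3 E2 = E1 / 2. In the E3-component the connection term cancels
    against the variation of [nil3_form] with the base point. *)
Lemma nil3_covariant_derivative (r X : 'rV[R]_2 -> 'rV[R]_3) (s w : 'rV[R]_2) :
  let C := covariant_derivative (@nil3_metric R) r X s w in
  let V := 'D_w r s in
  let tX := nil3_form (r s) (X s) in
  let tV := nil3_form (r s) V in
  [/\ C 0 0 = 'D_w X s 0 0 + (V 0 1 * tX + tV * X s 0 1) / 2,
      C 0 1 = 'D_w X s 0 1 - (V 0 0 * tX + tV * X s 0 0) / 2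
    & nil3_form (r s) C = nil3_form (r s) ('D_w X s)].
Proof.
move=> C V tX tV; rewrite {}/C {}/tX {}/tV {}/V /covariant_derivative.
move: ('D_w r s) ('D_w X s) (X s) (r s) => {w s r X} V D X p.
pose G k i j := christoffel (@nil3_metric R) k i j p.
have GE k i j : G k i j = 2^-1 * \sum_(l < 3) nil3_cogram p k l *
   (partial_gram (@nil3_metric R) i j l p + partial_gram (@nil3_metric R) j i l p
    - partial_gram (@nil3_metric R) l i j p).
  by rewrite /G /christoffel invmx_nil3_gram.
have cE k : (D + \row_k \sum_(i < 3) \sum_(j < 3) G k i j * V 0 i * X 0 j) 0 k
    = D 0 k + \sum_(i < 3) \sum_(j < 3) G k i j * V 0 i * X 0 j.
  by rewrite !mxE.
(* Twice the Christoffel symbols of the first kind; [sE] raises the index with a row of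
   [nil3_cogram]. *)
pose F l i j := partial_gram (@nil3_metric R) i j l p
  + partial_gram (@nil3_metric R) j i l p - partial_gram (@nil3_metric R) l i j p.
have sE k (a b c : R) : nil3_cogram p k 0 = a -> nil3_cogram p k 1 = b ->
    nil3_cogram p k 2 = c ->
    forall i j, G k i j = 2^-1 * (a * F 0 i j + b * F 1 i j + c * F 2 i j).
  by move=> <- <- <- i j; rewrite GE sum_ord3.
have g0 := sE 0 1 0 (- p 0 1 / 2); have g1 := sE 1 0 1 (p 0 0 / 2).
have g2 := sE 2 (- p 0 1 / 2) (p 0 0 / 2) (1 + (p 0 0 ^+ 2 + p 0 1 ^+ 2) / 4).
have {}g0 := g0 ltac:(by rewrite mxE) ltac:(by rewrite mxE) ltac:(by rewrite mxE).
have {}g1 := g1 ltac:(by rewrite mxE) ltac:(by rewrite mxE) ltac:(by rewrite mxE).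
have {}g2 := g2 ltac:(by rewrite mxE) ltac:(by rewrite mxE) ltac:(by rewrite mxE).
split; rewrite /nil3_form /xcoord /ycoord /zcoord;
  rewrite !cE !sum_ord3 ?g0 ?g1 ?g2 /F !partial_gram_nil3 !nil3_form_basis /=;
  by field.
Qed.

End Nil3_connection.

(** * Translation surfaces of type 4 *)

Lemma differentiable_vec3 (R : realType) (V : normedModType R) (f g h : V -> R)
    (s : V) :
  differentiable f s -> differentiable g s -> differentiable h s ->
  differentiable (fun t => vec3 (f t) (g t) (h t)) s.
Proof.
move=> df dg dh.
have -> : (fun t => vec3 (f t) (g t) (h t)) =
    (fun t => f t *: vec3 1 0 0) + (fun t => g t *: vec3 0 1 0)
    + (fun t => h t *: vec3 0 0 1).
  apply/funext => t; rewrite !fctE; apply/rowP => i; rewrite !mxE.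
  by case: (ord3_cases i) => -> /=; ring.
by apply: differentiableD; [apply: differentiableD|]; apply: differentiableZl.
Qed.

(** * Tangent planes of the surface *)

Section translation_surface.
Variables (R : realType) (I J : set R) (u v u' v' u'' v'' : R -> R).
Hypotheses (openI : open I) (openJ : open J).
Hypothesis du : forall x, I x -> is_derive x 1 u (u' x) /\ is_derive x 1 u' (u'' x).
Hypothesis dv : forall y, J y -> is_derive y 1 v (v' y) /\ is_derive y 1 v' (v'' y).

Local Notation r := (translation_surface4 u v).
Local Notation U := (rectangle I J).
Local Notation g := (@nil3_metric R).

(** [p] and [q] are the E3-components of the two coordinate tangent vectors; [W2] is the squared
    length of the normal vector - p E1 - q E2 + E3. *)
Let p (s : 'rV[R]_2) : R := u' (s 0 0).
Let q (s : 'rV[R]_2) : R := v' (s 0 1) - s 0 0.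
Let W2 (s : 'rV[R]_2) : R := 1 + p s ^+ 2 + q s ^+ 2.

Let W2_gt0 s : 0 < W2 s.
Proof. by rewrite ltr_wpDr ?sqr_ge0// ltr_pwDl// sqr_ge0. Qed.

Let is_derive_p s w : U s -> is_derive s w p (u'' (s 0 0) * w 0 0).
Proof. by move=> [/du[_ d] _]; exact: is_derive_comp_coord. Qed.

Let is_derive_q s w : U s -> is_derive s w q (v'' (s 0 1) * w 0 1 - w 0 0).
Proof.
move=> [_ /dv[_ d]]; have d1 := is_derive_comp_coord w d.
exact: is_deriveB d1 (is_derive_coord s w 0).
Qed.

Let differentiable_p s : U s -> differentiable p s.
Proof. by move=> [/du[_ d] _]; exact: differentiable_comp_coord d. Qed.

Let differentiable_q s : U s -> differentiable q s.
Proof.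
move=> [_ /dv[_ d]]; apply: differentiableB; last exact: differentiable_coord.
exact: differentiable_comp_coord d.
Qed.

(** Allows identities that hold on the rectangle to be differentiated at its points. *)
Lemma near_rectangle s : U s -> \near s, U s.
Proof.
have cc i : {for s, continuous (fun t : 'rV[R]_2 => t 0 i)}.
  exact/differentiable_continuous/differentiable_coord.
move=> [Is Js]; near=> t; split; near: t.
- by apply: (cc 0); exact: open_nbhs_nbhs.
- by apply: (cc 1); exact: open_nbhs_nbhs.
Unshelve. all: by end_near. Qed.

Lemma differentiable_translation_surface4 s : U s -> differentiable r s.
Proof.
move=> [/du[dus _] /dv[dvs _]].
have -> : r = fun t => vec3 (t 0 0) (t 0 1)
    (u (t 0 0) + v (t 0 1) - t 0 0 * t 0 1 * 2^-1).
  by apply/funext => t; rewrite translation_surface4E.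
have dx := @differentiable_coord R 1 2 s 0 0.
have dy := @differentiable_coord R 1 2 s 0 1.
apply: differentiable_vec3 => //.
have d1 := differentiable_comp_coord dus; have d2 := differentiable_comp_coord dvs.
apply: differentiableB; first exact: differentiableD.
by apply: differentiableM; [exact: differentiableM|exact: differentiable_cst].
Qed.

(** The derivative of - x y / 2 and the half terms of [nil3_form] add up to - x times the second
    entry of w, whence q = v' - x. *)
Lemma derive_translation_surface4 s (w : 'rV[R]_2) : U s ->
  [/\ 'D_w r s 0 0 = w 0 0, 'D_w r s 0 1 = w 0 1
    & nil3_form (r s) ('D_w r s) = p s * w 0 0 + q s * w 0 1].
Proof.
move=> Us; have diffr := differentiable_translation_surface4 Us.
have dr := diff_derivable (v := w) diffr.
have rE i t : r t 0 i = vec3 (t 0 0) (t 0 1)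
    (u (t 0 0) + v (t 0 1) - t 0 0 * t 0 1 / 2) 0 i.
  by rewrite translation_surface4E.
have rowE i l : is_derive s w (fun t => r t 0 i) l -> 'D_w r s 0 i = l.
  by move=> [_ <-]; have [_ ->] := is_derive_row i dr.
have D0 : 'D_w r s 0 0 = w 0 0.
  apply: rowE; under eq_fun do rewrite rE mxE /=; exact: is_derive_coord.
have D1 : 'D_w r s 0 1 = w 0 1.
  apply: rowE; under eq_fun do rewrite rE mxE /=; exact: is_derive_coord.
split=> //; have [/du[dus _] /dv[dvs _]] := Us.
have := is_derive_comp_coord w dus; have := is_derive_comp_coord w dvs.
move=> d2 d1; have dx := is_derive_coord s w 0; have dy := is_derive_coord s w 1.
have D2 : 'D_w r s 0 2 = u' (s 0 0) * w 0 0 + v' (s 0 1) * w 0 1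
    - (w 0 0 * s 0 1 + s 0 0 * w 0 1) / 2.
  apply: rowE; under eq_fun do rewrite rE mxE /=.
  by apply: is_derive_eq; rewrite /GRing.scale /=; field.
rewrite /nil3_form /xcoord /ycoord /zcoord D0 D1 D2 translation_surface4E !mxE /=.
by rewrite /p /q; field.
Qed.

Lemma immersion_translation_surface4 : immersion_on U r.
Proof.
move=> s Us; have dr := differentiable_translation_surface4 Us; split=> //.
apply/row_freeP.
have JE w : 'D_w r s = w *m 'J r s by rewrite deriveEjacobian.
(* The surface is a graph over the parameters, so projection to the first two coordinates is a right
   inverse of the Jacobian. *)
exists (\matrix_(i < 3, j < 2) (i == j :> nat)%:R).
apply/row_matrixP => i; rewrite row1 row_mul rowE -JE.
have [D0 D1 _] := derive_translation_surface4 (delta_mx 0 i) Us.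
apply/rowP => j; rewrite mxE sum_ord3 !mxE D0 D1 !mxE {D0 D1}.
by case: i => [[|[|//]] hi]; case: j => [[|[|//]] hj];
  rewrite /= !(mulr0, mulr1, addr0, add0r).
Qed.

(** * An arbitrary unit normal and its shape operator *)

Section unit_normal.
Variable N : 'rV[R]_2 -> 'rV[R]_3.
Hypothesis unitN : unit_normal_on g U r N.

(* The E3-component of the normal. *)
Let n s := nil3_form (r s) (N s).

(** Orthogonality to the two coordinate tangent vectors gives N = n (- p E1 - q E2 + E3); unit
    length then fixes n up to sign. *)
Lemma unit_normalE s : U s ->
  [/\ N s 0 0 = - (p s * n s), N s 0 1 = - (q s * n s) & n s ^+ 2 * W2 s = 1].
Proof.
move=> Us; have [_ orth unit] := unitN Us.
have orthE (w : 'rV[R]_2) : w 0 0 * N s 0 0 + w 0 1 * N s 0 1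
    + (p s * w 0 0 + q s * w 0 1) * n s = 0.
  have [D0 D1 D2] := derive_translation_surface4 w Us.
  by have := orth w; rewrite /nil3_metric D2 /xcoord /ycoord D0 D1.
have N0 : N s 0 0 = - (p s * n s).
  have := orthE (delta_mx 0 0); rewrite !mxE /=; lra.
have N1 : N s 0 1 = - (q s * n s).
  have := orthE (delta_mx 0 1); rewrite !mxE /=; lra.
split=> //; move: unit; rewrite /nil3_metric /xcoord /ycoord N0 N1 -/(n s) /W2.
by move=> e; rewrite -[RHS]e; ring.
Qed.

Lemma unit_normal_neq0 s : U s -> n s != 0.
Proof.
move=> Us; have [_ _ nW] := unit_normalE Us; apply: contra_eqN nW => /eqP ->.
by rewrite expr0n mul0r eq_sym oner_eq0.
Qed.

(** The sign of n is not fixed, so its derivative is found by implicit differentiation of n^2 W2 =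
    1. *)
Lemma derive_unit_normal s (w : 'rV[R]_2) : U s ->
  let dp := u'' (s 0 0) * w 0 0 in
  let dq := v'' (s 0 1) * w 0 1 - w 0 0 in
  let dn := - n s * (p s * dp + q s * dq) / W2 s in
  [/\ 'D_w N s 0 0 = - (dp * n s + p s * dn),
      'D_w N s 0 1 = - (dq * n s + q s * dn)
    & nil3_form (r s) ('D_w N s) = dn + n s * (p s * w 0 1 - q s * w 0 0) / 2].
Proof.
move=> Us dp dq l; have [diffN _ _] := unitN Us.
have dN i := is_derive_row i (diff_derivable (v := w) diffN).
have diffr := differentiable_translation_surface4 Us.
have dr i := is_derive_row i (diff_derivable (v := w) diffr).
have [D0 D1 D2] := derive_translation_surface4 w Us.
(* The product rule for n: the second summand comes from the motion of the base point in
   [nil3_form]. *)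
pose D : R := nil3_form (r s) ('D_w N s) + (w 0 1 * N s 0 0 - w 0 0 * N s 0 1) / 2.
have dn : is_derive s w n D.
  have := (dN 0, dN 1, dN 2, dr 0, dr 1); rewrite D0 D1 => -[[[[N0 N1] N2] r0] r1].
  rewrite /n /nil3_form /xcoord /ycoord /zcoord; apply: is_derive_eq.
  by rewrite /D /nil3_form /xcoord /ycoord /zcoord /GRing.scale /=; field.
have dps : is_derive s w p dp by exact: is_derive_p.
have dqs : is_derive s w q dq by exact: is_derive_q.
have nearE (f h : 'rV[R]_2 -> R) df dh : (forall t, U t -> f t = h t) ->
    is_derive s w f df -> is_derive s w h dh -> df = dh.
  move=> fh [_ <-] [_ <-]; apply: near_eq_derive; near=> t; apply: fh.
  by near: t; exact: near_rectangle.
have n0 := unit_normal_neq0 Us; have [N0 N1 nW] := unit_normalE Us.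
have W0 : W2 s != 0 by rewrite gt_eqF.
have <- : D = l.
  have dW : is_derive s w (fun t => n t ^+ 2 * W2 t)
      (2 * n s * D * W2 s + n s ^+ 2 * (2 * p s * dp + 2 * q s * dq)).
    by rewrite /W2; apply: is_derive_eq; rewrite /GRing.scale /=; ring.
  have := nearE _ _ _ _ (fun t Ut => let: And3 _ _ h := unit_normalE Ut in h) dW
    (is_derive_cst _ _ _).
  move=> e; have c0 : 2 * n s * W2 s != 0 by rewrite !mulf_neq0// pnatr_eq0.
  apply: (mulfI c0); apply/eqP; rewrite -subr_eq0; apply/eqP; rewrite -[RHS]e.
  by rewrite /l; field.
split.
- apply: (nearE (fun t => N t 0 0) (fun t => - (p t * n t)) _ _ _ (dN 0)).
    by move=> t /unit_normalE[].
  refine (is_derive_eq (is_deriveN (is_deriveM dps dn)) _).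
  by rewrite /GRing.scale /=; ring.
- apply: (nearE (fun t => N t 0 1) (fun t => - (q t * n t)) _ _ _ (dN 1)).
    by move=> t /unit_normalE[].
  refine (is_derive_eq (is_deriveN (is_deriveM dqs dn)) _).
  by rewrite /GRing.scale /=; ring.
- by rewrite /D N0 N1; field.
Unshelve. all: by end_near. Qed.

(** The last conclusion says that nabla_w N is tangent to the surface, which makes a shape operator
    exist. *)
Lemma covariant_unit_normal s (w : 'rV[R]_2) : U s ->
  let C := covariant_derivative g r N s w in
  let dp := u'' (s 0 0) * w 0 0 in
  let dq := v'' (s 0 1) * w 0 1 - w 0 0 in
  let dn := - n s * (p s * dp + q s * dq) / W2 s in
  let tV := p s * w 0 0 + q s * w 0 1 in
  [/\ C 0 0 = - (dp * n s + p s * dn) + (w 0 1 - tV * q s) * n s / 2,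
      C 0 1 = - (dq * n s + q s * dn) - (w 0 0 - tV * p s) * n s / 2
    & nil3_form (r s) C = p s * C 0 0 + q s * C 0 1].
Proof.
move=> Us C dp dq dn tV.
have [C0 C1 C2] := nil3_covariant_derivative r N s w.
have [D0 D1 D2] := derive_translation_surface4 w Us.
have [N0 N1 N2] := derive_unit_normal w Us.
have [n0 n1 _] := unit_normalE Us.
have {}C0 : C 0 0 = - (dp * n s + p s * dn) + (w 0 1 - tV * q s) * n s / 2.
  by rewrite /C C0 D1 D2 N0 n1 -/(n s) /tV /dn /dq /dp; field; rewrite gt_eqF.
have {}C1 : C 0 1 = - (dq * n s + q s * dn) - (w 0 0 - tV * p s) * n s / 2.
  by rewrite /C C1 D0 D2 N1 n0 -/(n s) /tV /dn /dq /dp; field; rewrite gt_eqF.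
split=> //; rewrite C0 C1 /C C2 N2 -/dp -/dq -/dn.
(* Tangency reduces to this relation, since the terms with [tV] cancel in p C_0 + q C_1. *)
have dnW : dn * W2 s = - n s * (p s * dp + q s * dq).
  by rewrite /dn mulfVK// gt_eqF.
by move: dnW; rewrite /W2 /tV; lra.
Qed.

(** The parameter entries of a tangent vector are its x- and y-coordinates, so row i holds those of
    - nabla N in the i-th parameter direction. *)
Definition shape_matrix s : 'M[R]_2 := \matrix_(i, j)
  - [:: covariant_derivative g r N s (delta_mx 0 i) 0 0;
        covariant_derivative g r N s (delta_mx 0 i) 0 1]`_j.

Lemma shape_operator_shape_matrix : shape_operator_on g U r N shape_matrix.
Proof.
move=> s Us w; have W0 : W2 s != 0 by rewrite gt_eqF.
have D := derive_translation_surface4 (w *m shape_matrix s) Us.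
have CE := fun z => covariant_unit_normal z Us.
have sE i j : shape_matrix s i j =
    - [:: covariant_derivative g r N s (delta_mx 0 i) 0 0;
          covariant_derivative g r N s (delta_mx 0 i) 0 1]`_j by rewrite mxE.
move: (covariant_derivative g r N s) CE sE => C CE sE.
have [C0 C1 C2] := CE w; have [D0 D1 D2] := D.
(* The explicit formula for C w is linear in w, so the two basis directions determine it. *)
have A0 : (w *m shape_matrix s) 0 0 = - C w 0 0.
  have [E0 _ _] := CE (delta_mx 0 0); have [F0 _ _] := CE (delta_mx 0 1).
  rewrite mxE sum_ord2 !sE /= C0 E0 F0 !mxE /=; by field.
have A1 : (w *m shape_matrix s) 0 1 = - C w 0 1.
  have [_ E1 _] := CE (delta_mx 0 0); have [_ F1 _] := CE (delta_mx 0 1).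
  rewrite mxE sum_ord2 !sE /= C1 E1 F1 !mxE /=; by field.
have nil3_formN a : nil3_form (r s) (- a) = - nil3_form (r s) a.
  by rewrite /nil3_form /xcoord /ycoord /zcoord !mxE; field.
apply: (@nil3_form_inj _ (r s)).
- by rewrite D0 A0 [RHS]mxE.
- by rewrite D1 A1 [RHS]mxE.
- by rewrite D2 A0 A1 nil3_formN C2; ring.
Qed.

(** The connection terms on the diagonal are p q n / 2 with opposite signs and cancel in the trace.
    The summand p q of [minimal_equation] comes from q_x = - 1 in the derivative of n. *)
Lemma mean_curvatureE A s : shape_operator_on g U r N A -> U s ->
  2 * mean_curvature (A s) * W2 s =
  n s * minimal_equation (p s) (q s) (u'' (s 0 0)) (v'' (s 0 1)).
Proof.
move=> shA Us; have W0 : W2 s != 0 by rewrite gt_eqF.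
have D := fun z => derive_translation_surface4 z Us.
have CE := fun z => covariant_unit_normal z Us.
have AE := shA s Us.
move: (covariant_derivative g r N s) CE AE => C CE AE.
have A00 : A s 0 0 = - C (delta_mx 0 0) 0 0.
  have [D0 _ _] := D (delta_mx 0 0 *m A s).
  by move: D0; rewrite AE -rowE mxE [RHS]mxE => <-.
have A11 : A s 1 1 = - C (delta_mx 0 1) 0 1.
  have [_ D1 _] := D (delta_mx 0 1 *m A s).
  by move: D1; rewrite AE -rowE mxE [RHS]mxE => <-.
have [E0 _ _] := CE (delta_mx 0 0); have [_ F1 _] := CE (delta_mx 0 1).
rewrite /mean_curvature /mxtrace sum_ord2 A00 A11 E0 F1 !mxE /=.
rewrite /minimal_equation mulVKf ?pnatr_eq0//.
by move: W0; rewrite /W2 => W0; field.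
Qed.

End unit_normal.

(** * The explicit unit normal and the minimality criterion *)

Let n0 s : R := (Num.sqrt (W2 s))^-1.

(** The vector n0 (- p E1 - q E2 + E3) in coordinates; the third entry is the one that gives
    [nil3_form] the value [n0]. *)
Let N0 s : 'rV[R]_3 := vec3 (- (p s * n0 s)) (- (q s * n0 s))
  (n0 s + (s 0 1 * p s - s 0 0 * q s) * n0 s / 2).

Lemma unit_normal_translation_surface4 : unit_normal_on g U r N0.
Proof.
move=> s Us.
have nW : n0 s ^+ 2 * W2 s = 1.
  by rewrite /n0 exprVn sqr_sqrtr ?ltW// mulVf// gt_eqF.
have formN : nil3_form (r s) (N0 s) = n0 s.
  rewrite /nil3_form /xcoord /ycoord /zcoord translation_surface4E !mxE /=.
  by field.
split.
- have dp := differentiable_p Us; have dq := differentiable_q Us.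
  have dx := @differentiable_coord R 1 2 s 0 0.
  have dy := @differentiable_coord R 1 2 s 0 1.
  have dW : differentiable W2 s.
    apply: differentiableD; last exact: (differentiableM dq dq).
    apply: differentiableD; first exact: differentiable_cst.
    exact: (differentiableM dp dp).
  have dn : differentiable n0 s.
    apply: differentiableV; last by rewrite gt_eqF// sqrtr_gt0.
    apply: (@differentiable_comp _ _ _ _ W2 Num.sqrt s) => //.
    by apply/derivable1_diffP; have [] := is_derive1_sqrt (W2_gt0 s).
  apply: differentiable_vec3.
  + by apply: differentiableN; exact: differentiableM.
  + by apply: differentiableN; exact: differentiableM.
  + apply: differentiableD => //.
    apply: differentiableM; last exact: differentiable_cst.
    apply: differentiableM => //.
    by apply: differentiableB; exact: differentiableM.
- move=> w; have [D0 D1 D2] := derive_translation_surface4 w Us.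
  by rewrite /nil3_metric D2 formN /xcoord /ycoord D0 D1 !mxE /=; ring.
- rewrite /nil3_metric formN /xcoord /ycoord !mxE /= -[RHS]nW /W2; ring.
Qed.

(** Neither n nor [W2] vanishes, so [mean_curvatureE] makes the two conditions equivalent; the
    converse supplies [N0] and its [shape_matrix]. *)
Lemma minimal_translation_surface4P :
  minimal_on g U r <->
  forall x y, I x -> J y ->
    minimal_equation (u' x) (v' y - x) (u'' x) (v'' y) = 0.
Proof.
split=> [[_ [N [A [unitN shA HA]]]] x y Ix Jy|E].
- pose s : 'rV[R]_2 := \row_(i < 2) [:: x; y]`_i.
  have [sx sy] : s 0 0 = x /\ s 0 1 = y by rewrite !mxE.
  have Us : U s by split; rewrite /= ?sx ?sy.
  have := mean_curvatureE unitN shA Us.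
  rewrite HA// mulr0 mul0r => /esym/eqP.
  by rewrite mulf_eq0 (negbTE (unit_normal_neq0 unitN Us)) /p /q sx sy => /eqP.
- split; first exact: immersion_translation_surface4.
  have unitN := unit_normal_translation_surface4.
  have shA := shape_operator_shape_matrix unitN.
  exists N0, (shape_matrix N0); split=> // s Us.
  have := mean_curvatureE unitN shA Us.
  have [Is Js] := Us; rewrite E// mulr0 => /eqP.
  by rewrite mulf_eq0 (gt_eqF (W2_gt0 s)) orbF mulf_eq0 pnatr_eq0 => /eqP.
Qed.

End translation_surface.

Theorem theorem3p2 (R : realType) (I J : set R) (u v : R -> R)
  (openI : open I) (intervalI : is_interval I) (I_neq0 : I !=set0)
  (openJ : open J) (intervalJ : is_interval J) (J_neq0 : J !=set0)
  (smooth_u : smooth_on I u) (smooth_v : smooth_on J v) :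
  minimal_on (@nil3_metric R) (rectangle I J) (translation_surface4 u v)
  <->
  exists a c u0 v0 : R,
    (forall x, I x ->
       u x = c * ((a + x) * Num.sqrt (1 + (a + x) ^+ 2)
                  + ln (a + x + Num.sqrt (1 + (a + x) ^+ 2))) + u0)
    /\ (forall y, J y -> v y = - a * y + v0).
Proof.
have minE := minimal_translation_surface4P openI openJ
  (smooth_on_derivable smooth_u) (smooth_on_derivable smooth_v).
have solE := minimal_equationP openI intervalI I_neq0 openJ intervalJ J_neq0
  smooth_u smooth_v.
exact: iff_trans minE solE.
Qed.
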